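(* Let $(X,\mathcal U^{+})$ be a quasi-uniform space, and write $\tau^{+}=\tau(\mathcal U^{+})$, $\tau^{-}=\tau((\mathcal U^{+})^{-1})$ and $\tau^\vee=\tau^{+}\vee\tau^{-}$. Then $(X,\tau^{+},\tau^{-})$ is locally antisymmetrically connected if and only if every point $x\in X$ admits a base of entourages whose induced $\tau^\vee$-neighborhoods are antisymmetrically connected, that is, for every $x\in X$ there is a base $\mathcal B_x\subseteq\mathcal U^{+}$ of the filter $\mathcal U^{+}$ such that for every $E\in\mathcal B_x$ the set $E(x)\cap E^{-1}(x)$ is antisymmetrically connected.
   Context: A quasi-uniformity on $X$ is a filter $\mathcal U$ on $X\times X$, whose members are called entourages, such that every $U\in\mathcal U$ contains the diagonal and for every $U\in\mathcal U$ there is $V\in\mathcal U$ with $V\circ V\subseteq U$. Its conjugate is $\mathcal U^{-1}=\{U^{-1}:U\in\mathcal U\}$, where $U^{-1}=\{(y,x):(x,y)\in U\}$. For an entourage $U$ and $x\in X$, $U(x)=\{y\in X:(x,y)\in U\}$, so $U^{-1}(x)=\{y\in X:(y,x)\in U\}$. The induced topology is $\tau(\mathcal U)=\{O\subseteq X:\forall x\in O\ \exists U\in\mathcal U,\ U(x)\subseteq O\}$. The join $\tau^{+}\vee\tau^{-}$ is the coarsest topology containing both. A bitopological space $(X,\tau^{+},\tau^{-})$ is antisymmetrically connected if there do not exist nonempty subsets $A,B\subseteq X$ with $X=A\cup B$, $A\cap B=\varnothing$, $A$ $\tau^{+}$-open and $B$ $\tau^{-}$-open. A subset of $X$ is antisymmetrically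 connected if it is so with the induced subspace topologies. $(X,\tau^{+},\tau^{-})$ is locally antisymmetrically connected at $x$ if every $\tau^\vee$-neighborhood $U$ of $x$ contains a $\tau^\vee$-neighborhood $V$ of $x$ that is antisymmetrically connected; it is locally antisymmetrically connected if this holds at every point. *)

(* Defs.v *)
From HB Require Import structures.
From mathcomp Require Import all_boot all_order all_algebra.
From mathcomp Require Import all_classical.
From mathcomp Require Import topology.

Set Implicit Arguments.
Unset Strict Implicit.
Unset Printing Implicit Defensive.

Local Open Scope classical_set_scope.
Local Open Scope relation_scope.

(* The entourage axioms of [Uniform] without symmetry. *)
Record quasi_uniformity (X : Type) := QuasiUniformity {
  qentourage : set_system (X * X);
  qentourage_filter : Filter qentourage;
  qentourage_diagonal : forall E, qentourage E -> diagonal `<=` E;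
  qentourage_split : forall E, qentourage E ->
    exists2 D, qentourage D & D \; D `<=` E
}.

Section conjugate.
Variables (X : Type) (U : quasi_uniformity X).

Definition conj_entourage : set_system (X * X) := [set E^-1 | E in qentourage U].

Let conj_filter : Filter conj_entourage.
Proof.
have UF := qentourage_filter U.
split.
- by exists setT; first exact: filterT.
- move=> _ _ [E UE <-] [D UD <-]; exists (E `&` D) => //.
  exact: filterI.
- move=> P E PE [D UD DP]; subst P; exists E^-1; last by apply/seteqP; split=> -[].
  by apply: filterS UD => -[x y] Dxy; exact: (PE (y, x)).
Qed.

Let conj_diagonal E : conj_entourage E -> diagonal `<=` E.
Proof.
by move=> [D UD <-] [x y] xy; apply: (qentourage_diagonal UD); symmetry.
Qed.

Let conj_split E : conj_entourage E ->
  exists2 D, conj_entourage D & D \; D `<=` E.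
Proof.
move=> [F UF <-]; have [D UD DDF] := qentourage_split UF.
exists D^-1; first by exists D.
by move=> [x y] [z Dzx Dyz]; apply: DDF; exists z.
Qed.

Definition conj_quasi_uniformity : quasi_uniformity X :=
  QuasiUniformity conj_filter conj_diagonal conj_split.

End conjugate.

Definition qopen (X : Type) (U : quasi_uniformity X) : set_system X :=
  [set O | forall x, O x -> exists2 E, qentourage U E & xsection E x `<=` O].

Definition quasi_topology_type (X : Type) (U : quasi_uniformity X) : Type := X.

Section quasi_topology.
Variables (X : choiceType) (U : quasi_uniformity X).

Let qopenT : qopen U setT.
Proof.
have UF := qentourage_filter U.
by move=> x _; exists setT => //; exact: filterT.
Qed.

Let qopenI : setI_closed (qopen U).
Proof.
have UF := qentourage_filter U.
move=> A B Aop Bop x [/Aop[E UE EA] /Bop[D UD DB]].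
by exists (E `&` D); [exact: filterI | rewrite xsectionI; exact: setISS].
Qed.

Let qopen_bigU (I : Type) (f : I -> set X) :
  (forall i, qopen U (f i)) -> qopen U (\bigcup_i f i).
Proof.
move=> fop x [i _ /fop[E UE Ef]]; exists E => //.
by move=> y /Ef fy; exists i.
Qed.

HB.instance Definition _ := Choice.on (quasi_topology_type U).
HB.instance Definition _ :=
  isOpenTopological.Build (quasi_topology_type U) qopenT qopenI qopen_bigU.

Definition quasi_topology : Topological X :=
  Topological.class (quasi_topology_type U).

End quasi_topology.

(* A bitopological space is a type X together with two topologies, given as
   inhabitants of the HB class [Topological X]. *)

Definition open_in (X : Type) (T : Topological X) : set_system X :=
  @open (Topological.Pack T).

Definition nbhs_in (X : Type) (T : Topological X) (x : X) : set_system X :=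
  @nbhs X (Topological.Pack T) x.

Definition join_topology (X : choiceType) (Tp Tm : Topological X) :
    Topological X :=
  Topological.class (sup_topology (fun b : bool => if b then Tp else Tm)).

Definition sub_topology (X : choiceType) (T : Topological X) (A : set X) :
    Topological A :=
  Topological.class
    (initial_topology (set_val : A -> Topological.Pack T)).

Definition antisym_connected (X : Type) (Tp Tm : Topological X) : Prop :=
  ~ exists A B : set X,
      [/\ A !=set0 /\ B !=set0, [set: X] = A `|` B, A `&` B = set0,
          open_in Tp A & open_in Tm B].

Definition antisym_connected_set (X : choiceType) (Tp Tm : Topological X)
    (S : set X) : Prop :=
  antisym_connected (sub_topology Tp S) (sub_topology Tm S).

Definition locally_antisym_connected_at (X : choiceType)
    (Tp Tm : Topological X) (x : X) : Prop :=
  forall N, nbhs_in (join_topology Tp Tm) x N ->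
    exists V, [/\ nbhs_in (join_topology Tp Tm) x V, V `<=` N &
                  antisym_connected_set Tp Tm V].

Definition locally_antisym_connected (X : choiceType)
    (Tp Tm : Topological X) : Prop :=
  forall x, locally_antisym_connected_at Tp Tm x.

Definition entourage_base (X : Type) (U : quasi_uniformity X)
    (B : set_system (X * X)) : Prop :=
  B `<=` qentourage U /\
  forall E, qentourage U E -> exists2 D, B D & D `<=` E.

(* Main.v *)
(** The neighbourhoods of [x] in the join topology are the supersets of the sets
    [E(x) `&` E^-1(x)]. If [V] is an antisymmetrically connected neighbourhood
    of [x] contained in [E(x) `&` E^-1(x)], and [F] is an entourage with
    [F(x) `&` F^-1(x) `<=` V], then [D = (E `&` F) `|` {x} `*` V `|` V `*` {x}]
    is an entourage contained in [E], and [D(x) `&` D^-1(x)] is exactly [V]. *)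
Require Import Defs.
From mathcomp Require Import all_boot all_order all_algebra.
From mathcomp Require Import all_classical.
From mathcomp Require Import topology.

Lemma nbhs_quasi_topology (X : choiceType) (U : quasi_uniformity X) (x : X)
    (N : set X) :
  nbhs_in (quasi_topology U) x N <->
  exists2 E, qentourage U E & (xsection E x `<=` N)%classic.
Proof.
split=> [[O [Oop Ox ON]]|[E UE EN]].
  by have [E UE EO] := Oop _ Ox; exists E => // y /EO /ON.
(* This set serves as the interior of [N]. It is open because, when [G \; G] lies in [D], each [z]
   in [G(y)] satisfies [G(z) <= D(y) <= N]. *)
exists [set y | exists2 D, qentourage U D & xsection D y `<=` N]%classic.
split; last 2 first.
- by exists E.
- move=> y [D UD]; apply; apply/xsectionP.
  exact: (qentourage_diagonal UD).
move=> y [D UD DN]; have [G UG GGD] := qentourage_split UD.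
exists G => // z /xsectionP Gyz; exists G => // w /xsectionP Gzw.
by apply/DN/xsectionP/GGD; exists z.
Qed.

(** By [cvg_sup], the neighbourhood filter of [x] in the join is the smallest filter containing the
    neighbourhoods of [x] in both topologies; the sets [E(x) & E^-1(x)] generate that filter. *)
Lemma nbhs_join_quasi_topology (X : choiceType) (U : quasi_uniformity X)
    (x : X) (N : set X) :
  nbhs_in (join_topology (quasi_topology U)
             (quasi_topology (conj_quasi_uniformity U))) x N <->
  exists2 E, qentourage U E &
    (xsection E x `&` xsection (E^-1)%relation x `<=` N)%classic.
Proof.
have UF := qentourage_filter U.
set Tc := fun b : bool => if b then quasi_topology U
  else quasi_topology (conj_quasi_uniformity U).
pose sec (E : set (X * X)) :=
  (xsection E x `&` xsection (E^-1)%relation x)%classic.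
split=> [xN|[E UE EN]].
  have secF : Filter (filter_from (qentourage U) sec).
    apply: filter_from_filter; first by exists setT; exact: filterT.
    move=> E D UE UD; exists (E `&` D)%classic; first exact: filterI.
    by move=> y [/xsectionP[? ?] /xsectionP[? ?]];
      split; split; apply/xsectionP.
  apply: (cvg_sup Tc x secF).2 xN.
  case=> A /nbhs_quasi_topology[E].
    by move=> UE EA; exists E => // y [/EA].
  by move=> [D UD <-] DA; exists D => // y [_ /DA].
pose T := Topological.class (sup_topology Tc).
have sub_nbhs b A : nbhs_in (Tc b) x A -> nbhs_in T x A.
  have nF : Filter (nbhs_in T x) by exact: nbhs_filter.
  (* The neighbourhood filter of the join converges to [x] in the join, hence in each of the two
     topologies. *)
  exact: (cvg_sup Tc x nF).1 (fun A xA => xA) b A.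
apply: (filterS EN); apply: filterI.
  by apply: (sub_nbhs true); apply/nbhs_quasi_topology; exists E.
apply: (sub_nbhs false); apply/nbhs_quasi_topology; exists (E^-1)%relation => //.
by exists E.
Qed.

Theorem theorem6p3 (X : choiceType) (U : quasi_uniformity X) :
  locally_antisym_connected
    (quasi_topology U) (quasi_topology (conj_quasi_uniformity U)) <->
  (forall x : X, exists B : set_system (X * X),
    entourage_base U B /\
    forall E, B E ->
      antisym_connected_set
        (quasi_topology U) (quasi_topology (conj_quasi_uniformity U))
        (xsection E x `&` xsection (E^-1)%relation x)%classic).
Proof.
have UF := qentourage_filter U.
split=> [lac x|bases x N /nbhs_join_quasi_topology[E UE EN]]; last first.
  have [B [[BU Bbase] Bconn]] := bases x.
  have [D BD DE] := Bbase _ UE.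
  exists (xsection D x `&` xsection (D^-1)%relation x)%classic.
  split; last exact: Bconn.
    by apply/nbhs_join_quasi_topology; exists D => //; exact: BU.
  move=> y [/xsectionP Dxy /xsectionP Dyx].
  by apply: EN; split; apply/xsectionP; apply: DE.
(* The largest possible candidate for the base: it remains to find such an entourage inside each
   [E]. *)
exists [set E | qentourage U E /\ antisym_connected_set
  (quasi_topology U) (quasi_topology (conj_quasi_uniformity U))
  (xsection E x `&` xsection (E^-1)%relation x)]%classic.
split; last by move=> E [].
split=> [E []//|E UE].
have [|V [xV VE Vconn]] :=
  lac x (xsection E x `&` xsection (E^-1)%relation x)%classic.
  by apply/nbhs_join_quasi_topology; exists E.
move/nbhs_join_quasi_topology: xV => [F UF1 FV].
pose D := ((E `&` F) `|` ([set x] `*` V) `|` (V `*` [set x]))%classic.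
have DE : (D `<=` E)%classic.
  move=> [a b] [[[]//|[/= -> Vb]]|[/= Va ->]].
    by have [/xsectionP] := VE _ Vb.
  by have [_ /xsectionP] := VE _ Va.
have Dx : (xsection D x `&` xsection (D^-1)%relation x)%classic = V.
  apply/seteqP; split=> [y [/xsectionP Dxy /xsectionP Dyx]|y Vy]; last first.
    by split; apply/xsectionP; [left; right|right].
  (* If [(x, y)] or [(y, x)] comes from an added strip, then [y] is in [V] directly, or [y = x] with
     [x] in [V]. Otherwise both pairs lie in [F], and [FV] applies. *)
  case: Dxy => [[[_ Fxy]|[]//]|[/= Vx ->]//].
  case: Dyx => [[[_ Fyx]|[/= -> //]]|[]//].
  by apply: FV; split; apply/xsectionP.
exists D => //; split; last by rewrite Dx.
by apply: filterS (filterI UE UF1) => z ?; left; left.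
Qed.
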